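(* Let $\mathbb{F}$ be a division ring, $\sigma$ an automorphism of $\mathbb{F}$, $\delta$ a $\sigma$-derivation of $\mathbb{F}$, and $\mathcal{R}=\mathbb{F}[x;\sigma,\delta]$. Let $f\in\mathcal{R}$, $a\in\mathbb{F}$ and let $r$ be a positive integer with $r<\deg f$. (Right version.) The following are equivalent: 1) $a$ is a right root of $f$ of multiplicity $\geq r$; 2) $a$ is a common right root of $f,\Delta_a^1f,\dots,\Delta_a^{r-1}f$; 3) $R^{\sigma,\delta}_{\mathbb{F},L}(\Delta_a^jf,\Delta_a^{j+1}f)=0$ for $j=0,\dots,r-1$; 4) $\mathrm{gcld}(\Delta_a^jf,\Delta_a^{j+1}f)\neq1$ for $j=0,\dots,r-1$. (Left version.) The following are equivalent: 1) $a$ is a left root of $f$ of multiplicity $\geq r$; 2) $a$ is a common left root of $f,\Delta_{a,L}^1f,\dots,\Delta_{a,L}^{r-1}f$; 3) $R^{\sigma,\delta}_{\mathbb{F}}(\Delta_{a,L}^jf,\Delta_{a,L}^{j+1}f)=0$ for $j=0,\dots,r-1$; 4) $\mathrm{gcrd}(\Delta_{a,L}^jf,\Delta_{a,L}^{j+1}f)\neq1$ for $j=0,\dots,r-1$. Here $\Delta_a^0f:=f$ and $\Delta_{a,L}^0f:=f$, so that $\Delta_a^0f(a)=f(a)$ and $(\Delta_{a,L}^0f)_L(a)=f_L(a)$.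
   Context: A $\sigma$-derivation is an additive map $\delta:\mathbb{F}\to\mathbb{F}$ with $\delta(ab)=\sigma(a)\delta(b)+\delta(a)b$. $\mathcal{R}=\mathbb{F}[x;\sigma,\delta]$ is the set of polynomials $\sum_i a_ix^i$ with usual addition and multiplication determined by $xa=\sigma(a)x+\delta(a)$, $a\in\mathbb{F}$. Since $\sigma$ is an automorphism, both right division ($f=qh+\rho$) and left division ($f=hq+\rho$) with remainder hold, and every element is uniquely of the form $\sum_i x^i\mathcal{A}_i$ (right-hand coefficients). $\mathrm{gcrd}$ and $\mathrm{gcld}$ denote the greatest common right and left divisor. The right (left) evaluation $f(a)$ ($f_L(a)$) is the remainder of the right (left) division of $f$ by $x-a$; $a$ is a right (left) root if it vanishes. $a$ is a right (left) root of $f$ of multiplicity $\ge r$ if $(x-a)^r$ divides $f$ on the right (left). For $r\ge1$, $\Delta_a^rf$ ($\Delta_{a,L}^rf$) is the quotient of the right (left) division of $f$ by $(x-a)^r$. Right resultant: for $h,k\in\mathcal{R}$ of degrees $m,n\ge0$, $R^{\sigma,\delta}_{\mathbb{F}}(h,k)$ is the Dieudonné determinant of the $(m+n)\times(m+n)$ matrix whose rows are, in order, the vectors of left coefficients with respect to $1,x,\dots,x^{m+n-1}$ of $h,xh,\dots,x^{n-1}h,k,xk,\dots,x^{m-1}k$. Left resultant: for $h,k\in\mathcal{R}$ of degrees $m,n\ge0$, $R^{\sigma,\delta}_{\mathbb{F},L}(h,k)$ is the Dieudonné determinant of the $(m+n)\times(m+n)$ matrix whose rows are, in order, the vectors of right-hand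 coefficients with respect to $1,x,\dots,x^{m+n-1}$ of $h,hx,\dots,hx^{n-1},k,kx,\dots,kx^{m-1}$. Explicitly, if $h=\sum_{i=0}^m x^iA_i$, the right-hand coefficient of $x^t$ in $hx^j$ is $\sum_{i=0}^{j}(-1)^{j+i}\mathcal{T}_{j-i,i}(A_{t-i})$ (with $A_s=0$ for $s\notin\{0,\dots,m\}$), where $\mathcal{T}_{p,q}(a)$ is the sum of all possible compositions of $p$ copies of $\delta\sigma^{-1}$ and $q$ copies of $\sigma^{-1}$ evaluated at $a$, $\mathcal{T}_{0,0}(a)=a$; similarly for $k$. The Dieudonné determinant takes values in $\{0\}\cup\mathbb{F}^*/[\mathbb{F}^*,\mathbb{F}^*]$, where $\mathbb{F}^*=\mathbb{F}\setminus\{0\}$.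
   Formalization: The left resultant is taken as the Dieudonné determinant of the transpose of the stated matrix (its determinant over the opposite ring); with the matrix as stated, 1)⇒3) fails over quaternions for f=(x−b)(x−a), ab≠ba, σ=id, δ=0, r=1. *)

(* Defs.v *)
From HB Require Import structures.
From mathcomp Require Import all_boot all_order all_algebra.
From mathcomp Require Import boolp classical_sets.

Set Implicit Arguments.
Unset Strict Implicit.
Unset Printing Implicit Defensive.

Import GRing.Theory.
Local Open Scope ring_scope.

Definition division_ring (F : unitRingType) : Prop :=
  forall x : F, x != 0 -> x \is a GRing.unit.

Record sigma_derivation (F : unitRingType) (sigma : F -> F) := SigmaDerivation {
  derivation_fun :> {additive F -> F};
  derivationM : forall a b : F,
    derivation_fun (a * b) = sigma a * derivation_fun b + derivation_fun a * b
}.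

(* F[x; sigma, delta]: the additive group {poly F} of polynomials with left
   coefficients, with the multiplication such that x a = sigma(a) x + delta(a). *)
Definition skew_poly (F : unitRingType) (sigma : {rmorphism F -> F})
  (delta : sigma_derivation sigma) : Type := {poly F}.

Section SkewPoly.
Variables (F : unitRingType) (sigma : {rmorphism F -> F}).
Variable delta : sigma_derivation sigma.
Local Notation R := (skew_poly delta).

HB.instance Definition _ := GRing.Zmodule.on R.

(* q |-> x q; the product with 'X below is that of {poly F}. *)
Definition skew_mulX (q : {poly F}) : {poly F} :=
  map_poly sigma q * 'X + map_poly delta q.

Definition skew_mul (p q : {poly F}) : {poly F} :=
  \sum_(i < size p) p`_i *: iter i skew_mulX q.

Lemma skew_mulX_coef q i :
  (skew_mulX q)`_i = (if i is j.+1 then sigma q`_j else 0) + delta q`_i.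
Proof.
rewrite coefD coefMX !coef_map_id0 ?raddf0 //.
by case: i => [|i] //=; rewrite coef_map_id0 ?raddf0.
Qed.

Fact skew_mulX_is_zmod_morphism : zmod_morphism skew_mulX.
Proof.
move=> p q; apply/polyP=> i; rewrite coefB !skew_mulX_coef coefB raddfB.
by case: i => [|i]; rewrite ?add0r ?coefB ?raddfB // opprD addrACA.
Qed.

HB.instance Definition _ := GRing.isZmodMorphism.Build {poly F} {poly F}
  skew_mulX skew_mulX_is_zmod_morphism.

Lemma skew_mulXZ a q :
  skew_mulX (a *: q) = sigma a *: skew_mulX q + delta a *: q.
Proof.
apply/polyP=> i; rewrite skew_mulX_coef [RHS]coefD !coefZ skew_mulX_coef derivationM.
by case: i => [|i]; rewrite ?coefZ ?rmorphM ?add0r // mulrDr addrA.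
Qed.

Fact skew_iter_is_zmod_morphism n : zmod_morphism (iter n skew_mulX).
Proof. by elim: n => [|n IHn] p q //=; rewrite IHn raddfB. Qed.

HB.instance Definition _ n := GRing.isZmodMorphism.Build {poly F} {poly F}
  (iter n skew_mulX) (skew_iter_is_zmod_morphism n).

Lemma skew_mulE N (p q : {poly F}) : (size p <= N)%N ->
  skew_mul p q = \sum_(i < N) p`_i *: iter i skew_mulX q.
Proof.
move=> lepN; rewrite /skew_mul (big_ord_widen _ (fun i => p`_i *: iter i skew_mulX q) lepN).
rewrite big_mkcond; apply: eq_bigr => i _; case: ltnP => // /(nth_default 0) ->.
by rewrite scale0r.
Qed.

Lemma skew_mulDl : left_distributive skew_mul +%R.
Proof.
move=> p q u; pose N := maxn (size p) (size q).
rewrite !(@skew_mulE N) ?leq_maxl ?leq_maxr ?size_polyD // -big_split.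
by apply: eq_bigr => i _; rewrite coefD scalerDl.
Qed.

Lemma skew_mulDr : right_distributive skew_mul +%R.
Proof.
move=> p q u; rewrite /skew_mul -big_split; apply: eq_bigr => i _.
by rewrite raddfD scalerDr.
Qed.

Lemma skew_mulZl a p q : skew_mul (a *: p) q = a *: skew_mul p q.
Proof.
rewrite (@skew_mulE (size p)) ?size_scale_leq // scaler_sumr.
by apply: eq_bigr => i _; rewrite coefZ scalerA.
Qed.

Lemma skew_mul_mulX p q : skew_mul (skew_mulX p) q = skew_mulX (skew_mul p q).
Proof.
have sXp : (size (skew_mulX p) <= (size p).+1)%N.
  apply/leq_sizeP => -[|i] // lti; rewrite skew_mulX_coef.
  by rewrite !nth_default ?raddf0 ?addr0 // ltnW.
rewrite (skew_mulE _ sXp) [skew_mul p q]/skew_mul raddf_sum big_ord_recl /=.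
under [RHS]eq_bigr => i _ do rewrite skew_mulXZ.
rewrite big_split /=; under [X in _ + X]eq_bigr do rewrite skew_mulX_coef scalerDl.
rewrite big_split /= addrCA; congr (_ + _).
have: \sum_(i < (size p).+1) delta p`_i *: iter i skew_mulX q =
      \sum_(i < size p) delta p`_i *: iter i skew_mulX q.
  by rewrite big_ord_recr /= nth_default // raddf0 scale0r addr0.
by rewrite big_ord_recl /= skew_mulX_coef add0r => ->.
Qed.

Lemma skew_mulA : associative skew_mul.
Proof.
move=> p q u; have iterA i (v w : {poly F}) :
  skew_mul (iter i skew_mulX v) w = iter i skew_mulX (skew_mul v w).
  by elim: i => //= i <-; rewrite skew_mul_mulX.
have mul0 (w : {poly F}) : skew_mul 0 w = 0 by rewrite /skew_mul size_poly0 big_ord0.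
rewrite {1}/skew_mul [skew_mul p q]/skew_mul.
rewrite (big_morph (skew_mul^~ u) (fun v w => skew_mulDl v w u) (mul0 u)).
by apply: eq_bigr => i _; rewrite skew_mulZl iterA.
Qed.

Lemma skew_mul1l : left_id 1 skew_mul.
Proof. by move=> p; rewrite /skew_mul size_poly1 big_ord1 coef1 scale1r. Qed.

Lemma skew_iterX n : iter n skew_mulX 1 = 'X^n.
Proof.
elim: n => [|n IHn] //=; rewrite IHn; apply/polyP => i.
have d1 : delta 1 = 0.
  have := derivationM delta 1 1; rewrite mulr1 rmorph1 mul1r mulr1.
  by move/(congr1 (fun t => t - delta 1)); rewrite subrr addrK.
rewrite skew_mulX_coef !coefXn; have -> (b : bool) : delta b%:R = 0.
  by case: b; rewrite ?d1 ?raddf0.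
by case: i => [|i]; rewrite !addr0 // coefXn rmorph_nat.
Qed.

Lemma skew_mul1r : right_id 1 skew_mul.
Proof.
move=> p; rewrite /skew_mul -[RHS]coefK poly_def.
by apply: eq_bigr => i _; rewrite skew_iterX.
Qed.

HB.instance Definition _ := GRing.Zmodule_isNzRing.Build R
  skew_mulA skew_mul1l skew_mul1r skew_mulDl skew_mulDr (oner_neq0 {poly F}).

Definition skewX : R := 'X.
Definition skewC (c : F) : R := c%:P.
Definition deg (p : R) : nat := (size p).-1.

Lemma mulXE (p : R) : skewX * p = skew_mulX p.
Proof.
rewrite /GRing.mul /= (@skew_mulE 2) ?size_polyX // big_ord_recl big_ord1.
by rewrite !coefX /= scale0r add0r scale1r.
Qed.

Lemma skewXnE n : skewX ^+ n = 'X^n.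
Proof. by rewrite -skew_iterX; elim: n => //= n <-; rewrite exprS mulXE. Qed.

Lemma mulCE c (p : R) : skewC c * p = c *: (p : {poly F}) :> {poly F}.
Proof.
rewrite /GRing.mul /= (@skew_mulE 1) ?size_polyC_leq1 // big_ord1 /=.
by rewrite coefC.
Qed.

Lemma skewX_mulC c : skewX * skewC c = skewC (sigma c) * skewX + skewC (delta c).
Proof.
rewrite mulXE /skew_mulX mulCE; congr (_ + _); last exact: map_polyC.
by rewrite (map_polyC sigma) mul_polyC.
Qed.

Definition rdivides (d f : R) : Prop := exists q : R, f = q * d.
Definition ldivides (d f : R) : Prop := exists q : R, f = d * q.

Definition is_rdivision (f h : R) (u : R * R) : Prop :=
  f = u.1 * h + u.2 /\ (size u.2 < size h)%N.
Definition is_ldivision (f h : R) (u : R * R) : Prop :=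
  f = h * u.1 + u.2 /\ (size u.2 < size h)%N.

Definition rdivision (f h : R) : R * R := xget (0, f) (is_rdivision f h).
Definition ldivision (f h : R) : R * R := xget (0, f) (is_ldivision f h).

Definition rquo f h : R := (rdivision f h).1.
Definition rrem f h : R := (rdivision f h).2.
Definition lquo f h : R := (ldivision f h).1.
Definition lrem f h : R := (ldivision f h).2.

Definition skew_monic (d : R) : Prop := lead_coef d = 1.

Definition is_gcrd (g h d : R) : Prop :=
  [/\ skew_monic d, rdivides d g, rdivides d h &
      forall e, rdivides e g -> rdivides e h -> rdivides e d].
Definition is_gcld (g h d : R) : Prop :=
  [/\ skew_monic d, ldivides d g, ldivides d h &
      forall e, ldivides e g -> ldivides e h -> ldivides e d].

Definition gcrd (g h : R) : R := xget 0 (is_gcrd g h).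
Definition gcld (g h : R) : R := xget 0 (is_gcld g h).

(* The element \sum_i x^i A_i with right-hand coefficients A_i. *)
Definition of_rcoefs (A : {poly F}) : R :=
  \sum_(i < size A) skewX ^+ i * skewC A`_i.

Definition rcoefs (f : R) : {poly F} := xget 0 [set A | f = of_rcoefs A].

Section DivisionRing.
Hypotheses (F_div : division_ring F) (sigma_bij : bijective sigma).

Lemma iter_skew_mulX_coef n k (q : {poly F}) : (size q <= k.+1)%N ->
  (size (iter n skew_mulX q) <= (n + k).+1)%N /\
  (iter n skew_mulX q)`_(n + k) = iter n sigma q`_k.
Proof.
move=> sq; elim: n => [|n [IHs IHc]] //=; split; last first.
  by rewrite addSn skew_mulX_coef IHc [X in delta X]nth_default ?raddf0 ?addr0.
apply/leq_sizeP => -[|i] // lti; rewrite skew_mulX_coef.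
rewrite !nth_default ?rmorph0 ?raddf0 ?addr0 //.
  exact: leq_trans IHs (ltnW lti).
exact: leq_trans IHs lti.
Qed.

Lemma skew_mul_coef m n (p q : R) : (size p <= m.+1)%N -> (size q <= n.+1)%N ->
  (size (p * q)%R <= (m + n).+1)%N /\ (p * q)`_(m + n) = p`_m * iter m sigma q`_n.
Proof.
move=> sp sq; rewrite [p * q](skew_mulE q sp) big_ord_recr /=.
have [si ci] := iter_skew_mulX_coef m sq.
have slow : (size (\sum_(i < m) p`_i *: iter i skew_mulX q)%R <= m + n)%N.
  apply: (leq_trans (size_sum _ _ _)); apply/bigmax_leqP => i _.
  apply: (leq_trans (size_scale_leq _ _)).
  apply: (leq_trans (iter_skew_mulX_coef i sq).1).
  by rewrite -addSn leq_add2r.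
split; last by rewrite coefD coefZ ci nth_default ?add0r.
rewrite (leq_trans (size_polyD _ _)) // geq_max (leq_trans slow) //=.
exact: leq_trans (size_scale_leq _ _) si.
Qed.

Lemma skew_iter_sigma_unit n (c : F) :
  c != 0 -> iter n sigma c \is a GRing.unit.
Proof.
by move=> c0; elim: n => [|n IHn]; [apply: F_div | apply: rmorph_unit].
Qed.

Lemma skew_iter_sigma_surj n (c : F) : exists b, iter n sigma b = c.
Proof.
have [tau _ tauK] := sigma_bij; exists (iter n tau c).
by elim: n c => //= n IHn c; rewrite -iterS iterSr tauK IHn.
Qed.

Lemma size_skew_mul (p q : R) : p != 0 -> q != 0 ->
  size (p * q)%R = (size p + size q).-1.
Proof.
move=> p0 q0.
have sp : (0 < size p)%N by rewrite lt0n size_poly_eq0.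
have sq : (0 < size q)%N by rewrite lt0n size_poly_eq0.
have [] := @skew_mul_coef (size p).-1 (size q).-1 p q; rewrite ?prednK //.
move=> le cE; have -> : (size p + size q).-1 = ((size p).-1 + (size q).-1).+1.
  by case: (size p) sp => // ?; case: (size q) sq => // ?; rewrite addnS.
apply/eqP; rewrite eqn_leq le ltnNge; apply/negP => /(nth_default 0).
move/eqP; rewrite cE; have pu : p`_(size p).-1 \is a GRing.unit.
  by apply: F_div; rewrite -lead_coefE lead_coef_eq0.
have qu : iter (size p).-1 sigma q`_(size q).-1 \is a GRing.unit.
  by apply: skew_iter_sigma_unit; rewrite -lead_coefE lead_coef_eq0.
by move/eqP => e0; have := unitrMl p`_(size p).-1 qu; rewrite e0 pu unitr0.
Qed.

Lemma skew_mul_neq0 (p q : R) : p != 0 -> q != 0 -> p * q != 0.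
Proof.
move=> p0 q0; rewrite -size_poly_eq0 size_skew_mul // -lt0n.
move: p0 q0; rewrite -!size_poly_eq0.
by case: (size p) => // ?; case: (size q) => // ?; rewrite addnS.
Qed.

Lemma size_skew_mul_lt (p q : R) :
  (size (p * q)%R < size q)%N \/ (size (p * q)%R < size p)%N -> p = 0 \/ q = 0.
Proof.
have [->|p0] := eqVneq p 0; first by left.
have [->|q0] := eqVneq q 0; first by right.
rewrite size_skew_mul //; move: p0 q0; rewrite -!size_poly_eq0.
case: (size p) => // m _; case: (size q) => // n _; rewrite addSn addnS /=.
by case; rewrite ltnS leqNgt ltnS ?leq_addl ?leq_addr.
Qed.

(* Both divisions exist because the leading term of f can be cancelled. *)
Lemma rdivision_exists (f h : R) : h != 0 -> exists u, is_rdivision f h u.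
Proof.
move=> h0; have [m sh] : exists m, size h = m.+1.
  by exists (size h).-1; rewrite prednK // lt0n size_poly_eq0.
have: (size f <= size f)%N by []; move: {2}(size f) => n.
elim: n f => [|n IHn] f lefn.
  by exists (0, f); split; rewrite /= ?mul0r ?add0r // sh (leq_ltn_trans lefn).
have [lt_fh|le_hf] := ltnP (size f) (size h).
  by exists (0, f); split; rewrite /= ?mul0r ?add0r.
have [lefn'|gtfn] := leqP (size f) n; first exact: IHn.
have {gtfn lefn} sf : size f = n.+1 by apply/eqP; rewrite eqn_leq lefn.
move: le_hf; rewrite sf sh ltnS => le_mn.
pose c := f`_n / iter (n - m) sigma h`_m; pose t : R := (c *: 'X^(n - m) : {poly F}).
have st : (size t <= (n - m).+1)%N by rewrite (leq_trans (size_scale_leq _ _)) ?size_polyXn.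
have [sth cth] := skew_mul_coef st (eq_leq sh).
have hu : iter (n - m) sigma h`_m \is a GRing.unit.
  apply: skew_iter_sigma_unit; have := h0; rewrite -lead_coef_eq0 lead_coefE.
  by rewrite sh.
have [|[q u] /= [fE su]] := IHn (f - t * h).
  apply/leq_sizeP => j; rewrite leq_eqVlt coefB => /predU1P[<-|lt_nj].
    rewrite subnK // in cth; rewrite cth coefZ coefXn eqxx mulr1 divrK // subrr.
    by [].
  rewrite !nth_default ?subr0 ?sf //.
  by apply: leq_trans sth _; rewrite subnK.
exists (t + q, u); split=> //=; first by rewrite mulrDl -addrA -fE addrC subrK.
Qed.

Lemma ldivision_exists (f h : R) : h != 0 -> exists u, is_ldivision f h u.
Proof.
move=> h0; have [m sh] : exists m, size h = m.+1.
  by exists (size h).-1; rewrite prednK // lt0n size_poly_eq0.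
have: (size f <= size f)%N by []; move: {2}(size f) => n.
elim: n f => [|n IHn] f lefn.
  by exists (0, f); split; rewrite /= ?mulr0 ?add0r // sh (leq_ltn_trans lefn).
have [lt_fh|le_hf] := ltnP (size f) (size h).
  by exists (0, f); split; rewrite /= ?mulr0 ?add0r.
have [lefn'|gtfn] := leqP (size f) n; first exact: IHn.
have {gtfn lefn} sf : size f = n.+1 by apply/eqP; rewrite eqn_leq lefn.
move: le_hf; rewrite sf sh ltnS => le_mn.
have hu : h`_m \is a GRing.unit.
  by apply: F_div; have := h0; rewrite -lead_coef_eq0 lead_coefE sh.
have [c cE] := skew_iter_sigma_surj m ((h`_m)^-1 * f`_n).
pose t : R := (c *: 'X^(n - m) : {poly F}).
have st : (size t <= (n - m).+1)%N by rewrite (leq_trans (size_scale_leq _ _)) ?size_polyXn.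
have [sth cth] := skew_mul_coef (eq_leq sh) st.
have [|[q u] /= [fE su]] := IHn (f - h * t).
  apply/leq_sizeP => j; rewrite leq_eqVlt coefB => /predU1P[<-|lt_nj].
    rewrite subnKC // in cth; rewrite cth coefZ coefXn eqxx mulr1 cE mulVKr //.
    by rewrite subrr.
  rewrite !nth_default ?subr0 ?sf //.
  by apply: leq_trans sth _; rewrite subnKC.
exists (t + q, u); split=> //=; first by rewrite mulrDr -addrA -fE addrC subrK.
Qed.

Lemma rdivisionP (f h : R) : h != 0 -> is_rdivision f h (rdivision f h).
Proof. by move=> h0; apply: xgetPex; apply: rdivision_exists. Qed.

Lemma ldivisionP (f h : R) : h != 0 -> is_ldivision f h (ldivision f h).
Proof. by move=> h0; apply: xgetPex; apply: ldivision_exists. Qed.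

Lemma rdivision_uniq (f h : R) u v :
  is_rdivision f h u -> is_rdivision f h v -> u = v.
Proof.
case: u v => [q s] [q' s'] [/= e lts] [/= e' lts'].
have eB : (q - q') * h = s' - s.
  by apply/eqP; rewrite mulrBl subr_eq addrAC eq_sym subr_eq addrC -e' -e.
have ltB : (size (s' - s)%R < size h)%N.
  by rewrite (leq_ltn_trans (size_polyD _ _)) // size_polyN gtn_max lts lts'.
have h0 : h != 0 by rewrite -size_poly_eq0 -lt0n (leq_ltn_trans _ lts).
rewrite -eB in ltB; have [/eqP|/eqP] := size_skew_mul_lt (or_introl ltB).
  rewrite subr_eq0 => /eqP eq_q; move: eB; rewrite eq_q subrr mul0r.
  by move/esym/eqP; rewrite subr_eq0 => /eqP->.
by rewrite (negPf h0).
Qed.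

Lemma ldivision_uniq (f h : R) u v :
  is_ldivision f h u -> is_ldivision f h v -> u = v.
Proof.
case: u v => [q s] [q' s'] [/= e lts] [/= e' lts'].
have eB : h * (q - q') = s' - s.
  by apply/eqP; rewrite mulrBr subr_eq addrAC eq_sym subr_eq addrC -e' -e.
have ltB : (size (s' - s)%R < size h)%N.
  by rewrite (leq_ltn_trans (size_polyD _ _)) // size_polyN gtn_max lts lts'.
have h0 : h != 0 by rewrite -size_poly_eq0 -lt0n (leq_ltn_trans _ lts).
rewrite -eB in ltB; have [/eqP|/eqP] := size_skew_mul_lt (or_intror ltB).
  by rewrite (negPf h0).
rewrite subr_eq0 => /eqP eq_q; move: eB; rewrite eq_q subrr mulr0.
by move/esym/eqP; rewrite subr_eq0 => /eqP->.
Qed.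

Lemma gcrd_exists (g h : R) : g != 0 \/ h != 0 -> exists d, is_gcrd g h d.
Proof.
move=> gh0; have: exists d u v, [/\ rdivides d g, rdivides d h & d = u * g + v * h].
  have: (size h <= size h)%N by []; move: {2}(size h) => n {gh0}.
  elim: n g h => [|n IHn] g h.
    rewrite leqn0 size_poly_eq0 => /eqP->; exists g, 1, 0.
    by split; [exists 1 | exists 0 |]; rewrite ?mul1r ?mul0r ?addr0.
  move=> leh; have [h0|h0] := eqVneq h 0.
    by apply: IHn; rewrite h0 size_poly0.
  have [[q s] /= [gE lts]] := rdivision_exists g h0.
  have [|d [u [v [[a ha] [b sb] dE]]]] := IHn h s.
    by rewrite -ltnS (leq_trans lts).
  exists d, v, (u - v * q); split; last 1 first.
  - by rewrite gE mulrDr mulrBl mulrA addrC addrA subrK.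
  - by exists (q * a + b); rewrite mulrDl -mulrA -ha -sb.
  - by exists a.
case=> d [u [v [[a ga] [b hb] dE]]].
have d0 : d != 0.
  by apply/eqP => d0; case: gh0 => /eqP[]; rewrite ?ga ?hb d0 mulr0.
have lu : lead_coef d \is a GRing.unit by apply: F_div; rewrite lead_coef_eq0.
pose c := (lead_coef d)^-1; exists (skewC c * d); split.
- rewrite /skew_monic mulCE; rewrite lead_coefE.
  have -> : size (c *: (d : {poly F})) = size d.
    by apply: lreg_size; apply: mulrI; rewrite unitrV.
  by rewrite coefZ -lead_coefE mulVr.
- exists (a * skewC (lead_coef d)); rewrite -mulrA [skewC _ * _]mulrA.
  rewrite [skewC _ * skewC _]mulCE /skewC -mul_polyC -polyCM divrr //.
  by rewrite ga; congr (_ * _); rewrite -[LHS]mul1r.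
- exists (b * skewC (lead_coef d)); rewrite -mulrA [skewC _ * _]mulrA.
  rewrite [skewC _ * skewC _]mulCE /skewC -mul_polyC -polyCM divrr //.
  by rewrite hb; congr (_ * _); rewrite -[LHS]mul1r.
- move=> e [a' ga'] [b' hb']; exists (skewC c * (u * a' + v * b')).
  by rewrite dE {1}ga' {1}hb' !mulrDr !mulrDl !mulrA.
Qed.

Lemma gcld_exists (g h : R) : g != 0 \/ h != 0 -> exists d, is_gcld g h d.
Proof.
move=> gh0; have: exists d u v, [/\ ldivides d g, ldivides d h & d = g * u + h * v].
  have: (size h <= size h)%N by []; move: {2}(size h) => n {gh0}.
  elim: n g h => [|n IHn] g h.
    rewrite leqn0 size_poly_eq0 => /eqP->; exists g, 1, 0.
    by split; [exists 1 | exists 0 |]; rewrite ?mulr1 ?mulr0 ?addr0.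
  move=> leh; have [h0|h0] := eqVneq h 0.
    by apply: IHn; rewrite h0 size_poly0.
  have [[q s] /= [gE lts]] := ldivision_exists g h0.
  have [|d [u [v [[a ha] [b sb] dE]]]] := IHn h s.
    by rewrite -ltnS (leq_trans lts).
  exists d, v, (u - q * v); split; last 1 first.
  - by rewrite gE mulrDl mulrBr mulrA addrC addrA subrK.
  - by exists (a * q + b); rewrite mulrDr mulrA -ha -sb.
  - by exists a.
case=> d [u [v [[a ga] [b hb] dE]]].
have d0 : d != 0.
  by apply/eqP => d0; case: gh0 => /eqP[]; rewrite ?ga ?hb d0 mul0r.
have lu : lead_coef d \is a GRing.unit by apply: F_div; rewrite lead_coef_eq0.
have sd : (0 < size d)%N by rewrite lt0n size_poly_eq0.
have [c cE] := skew_iter_sigma_surj (size d).-1 (lead_coef d)^-1.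
have [e eE] : exists e, c * e = 1.
  have c0 : c != 0.
    apply: contraTneq lu => c0; rewrite -unitrV -cE c0.
    suff -> : iter (size d).-1 sigma 0 = 0 by rewrite unitr0.
    by elim: (_.-1) => //= k ->; rewrite rmorph0.
  by exists c^-1; rewrite divrr ?F_div.
have ce1 : skewC c * skewC e = 1 by rewrite mulCE /skewC -mul_polyC -polyCM eE.
have [] := @skew_mul_coef (size d).-1 0 d (skewC c).
- by rewrite prednK.
- exact: size_polyC_leq1.
rewrite addn0 coefC /= -lead_coefE cE divrr // => le1 cf1.
exists (d * skewC c); split.
- rewrite /skew_monic lead_coefE; have -> // : size (d * skewC c)%R = (size d).-1.+1.
  apply/eqP; rewrite eqn_leq le1 ltnNge; apply/negP => /(nth_default 0)/eqP.
  by rewrite cf1 oner_eq0.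
- by exists (skewC e * a); rewrite -mulrA [skewC c * _]mulrA ce1 mul1r.
- by exists (skewC e * b); rewrite -mulrA [skewC c * _]mulrA ce1 mul1r.
- move=> z [a' ga'] [b' hb']; exists ((a' * u + b' * v) * skewC c).
  by rewrite dE {1}ga' {1}hb' !mulrA mulrDr !mulrA.
Qed.

Lemma gcrdP (g h : R) : g != 0 \/ h != 0 -> is_gcrd g h (gcrd g h).
Proof. by move=> gh0; apply: xgetPex; apply: gcrd_exists. Qed.

Lemma gcldP (g h : R) : g != 0 \/ h != 0 -> is_gcld g h (gcld g h).
Proof. by move=> gh0; apply: xgetPex; apply: gcld_exists. Qed.

Lemma skew_monic_neq0 (d : R) : skew_monic d -> d != 0.
Proof. by move=> d1; rewrite -lead_coef_eq0 d1 oner_eq0. Qed.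

Lemma size1_skewC (p : R) : size p = 1%N -> exists c, p = skewC c.
Proof. by move=> s1; exists p`_0; apply: size1_polyC; rewrite s1. Qed.

Lemma gcrd_uniq (g h d e : R) : is_gcrd g h d -> is_gcrd g h e -> d = e.
Proof.
case=> d1 dg dh dmax [e1 eg eh emax].
have [d0 e0] := (skew_monic_neq0 d1, skew_monic_neq0 e1).
have [[a dE] [b eE]] := (dmax e eg eh, emax d dg dh).
have a0 : a != 0 by apply: contra_neq d0 => a0; rewrite dE a0 mul0r.
have b0 : b != 0 by apply: contra_neq e0 => b0; rewrite eE b0 mul0r.
have [c aE] : exists c, a = skewC c.
  apply: size1_skewC; move/(congr1 (fun p : R => size p)): eE.
  move/(congr1 (fun p : R => size p)): (dE); rewrite !size_skew_mul //.
  move: a0 b0 d0 e0; rewrite -!size_poly_eq0.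
  case: (size a) => // i _; case: (size b) => // j _; case: (size d) => // k _.
  case: (size e) => // l _; rewrite !addSn !addnS /= => -[->] [].
  by rewrite addnA => /(congr1 (subn^~ l)); rewrite subnn addnK; case: i => //; case: j.
have cE : c = 1.
  have := d1; rewrite dE aE /skew_monic mulCE.
  have cu : c \is a GRing.unit.
    by apply: F_div; apply: contra_neq a0 => c0; rewrite aE c0 /skewC polyC0.
  by rewrite lead_coefE (lreg_size _ (mulrI cu)) coefZ -lead_coefE e1 mulr1.
by rewrite dE aE cE mul1r.
Qed.

Lemma gcld_uniq (g h d e : R) : is_gcld g h d -> is_gcld g h e -> d = e.
Proof.
case=> d1 dg dh dmax [e1 eg eh emax].
have [d0 e0] := (skew_monic_neq0 d1, skew_monic_neq0 e1).
have [[a dE] [b eE]] := (dmax e eg eh, emax d dg dh).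
have a0 : a != 0 by apply: contra_neq d0 => a0; rewrite dE a0 mulr0.
have b0 : b != 0 by apply: contra_neq e0 => b0; rewrite eE b0 mulr0.
have sde : size a = 1%N /\ size d = size e.
  move/(congr1 (fun p : R => size p)): eE.
  move/(congr1 (fun p : R => size p)): (dE); rewrite !size_skew_mul //.
  move: a0 b0 d0 e0; rewrite -!size_poly_eq0.
  case: (size a) => // i _; case: (size b) => // j _; case: (size d) => // k _.
  case: (size e) => // l _; rewrite !addSn !addnS /= => -[->] [].
  rewrite -addnA => /(congr1 (subn^~ l)); rewrite subnn addKn.
  by case: i => [|i] //; rewrite addn0.
have [c aE] := size1_skewC sde.1.
have [] := @skew_mul_coef (size e).-1 0 e (skewC c).
- by rewrite prednK // lt0n size_poly_eq0.
- exact: size_polyC_leq1.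
rewrite addn0 coefC /= -lead_coefE e1 mul1r -aE -dE -sde.2 -lead_coefE d1 => _ c1.
have tau1 k : iter k sigma 1 = 1 by elim: k => //= k ->; rewrite rmorph1.
have injk k : injective (iter k sigma).
  by elim: k => // k IHk x y /= /(bij_inj sigma_bij)/IHk.
have cE : c = 1 by apply: (injk (size d).-1); rewrite -c1 tau1.
by rewrite dE aE cE mulr1.
Qed.

Lemma of_rcoefsE N (A : {poly F}) : (size A <= N)%N ->
  of_rcoefs A = \sum_(i < N) skewX ^+ i * skewC A`_i.
Proof.
move=> leAN; rewrite /of_rcoefs.
rewrite (big_ord_widen _ (fun i => skewX ^+ i * skewC A`_i) leAN) big_mkcond.
apply: eq_bigr => i _; case: ltnP => // /(nth_default 0) ->.
by rewrite /skewC polyC0 mulr0.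
Qed.

Lemma of_rcoefsD (A B : {poly F}) : of_rcoefs (A + B) = of_rcoefs A + of_rcoefs B.
Proof.
pose N := maxn (size A) (size B).
rewrite !(@of_rcoefsE N) ?leq_maxl ?leq_maxr ?size_polyD // -big_split.
by apply: eq_bigr => i _; rewrite coefD /skewC polyCD mulrDr.
Qed.

Lemma of_rcoefs_monomial n c : of_rcoefs (c *: 'X^n) = skewX ^+ n * skewC c.
Proof.
rewrite (@of_rcoefsE n.+1); last first.
  by rewrite (leq_trans (size_scale_leq _ _)) ?size_polyXn.
rewrite big_ord_recr /= coefZ coefXn eqxx mulr1 big1 ?add0r // => i _.
by rewrite coefZ coefXn ltn_eqF // mulr0 /skewC polyC0 mulr0.
Qed.

Lemma of_rcoefs_coef n (A : {poly F}) : (size A <= n.+1)%N ->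
  (size (of_rcoefs A) <= n.+1)%N /\ (of_rcoefs A)`_n = iter n sigma A`_n.
Proof.
have monoP k c : (size (skewX ^+ k * skewC c)%R <= k.+1)%N /\
    (skewX ^+ k * skewC c)`_k = iter k sigma c.
  have [] := @skew_mul_coef k 0 (skewX ^+ k) (skewC c).
  - by rewrite skewXnE size_polyXn.
  - exact: size_polyC_leq1.
  by rewrite addn0 skewXnE coefXn eqxx mul1r coefC.
move=> sA; rewrite (of_rcoefsE sA) big_ord_recr /=.
have slow : (size (\sum_(i < n) skewX ^+ i * skewC A`_i)%R <= n)%N.
  apply: (leq_trans (size_sum _ _ _)); apply/bigmax_leqP => i _.
  exact: leq_trans (monoP _ _).1 _.
split; last by rewrite coefD (monoP _ _).2 nth_default ?add0r.
rewrite (leq_trans (size_polyD _ _)) // geq_max (leq_trans slow) //=.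
exact: (monoP _ _).1.
Qed.

Lemma of_rcoefs_inj : injective of_rcoefs.
Proof.
move=> A B eqAB; apply/eqP; rewrite -subr_eq0; apply/negP => /negP AB0.
have AB : of_rcoefs (A - B) = 0.
  by apply: (addIr (of_rcoefs B)); rewrite -of_rcoefsD subrK add0r.
have sAB : (0 < size (A - B)%R)%N by rewrite lt0n size_poly_eq0.
have [] := @of_rcoefs_coef (size (A - B)%R).-1 (A - B); first by rewrite prednK.
move=> _; rewrite AB coef0 -lead_coefE => e0.
have := @skew_iter_sigma_unit (size (A - B)%R).-1 (lead_coef (A - B)).
by rewrite lead_coef_eq0 -e0 unitr0 => /(_ AB0).
Qed.

Lemma of_rcoefs_surj (f : R) : exists A, f = of_rcoefs A.
Proof.
have: (size f <= size f)%N by []; move: {2}(size f) => n.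
elim: n f => [|n IHn] f.
  rewrite leqn0 size_poly_eq0 => /eqP->; exists 0.
  by rewrite /of_rcoefs size_poly0 big_ord0.
move=> sf; have [c cE] := skew_iter_sigma_surj n f`_n.
have [|] := @of_rcoefs_coef n (c *: 'X^n).
  by rewrite (leq_trans (size_scale_leq _ _)) ?size_polyXn.
rewrite coefZ coefXn eqxx mulr1 cE => sm cm.
have [|A fE] := IHn (f - of_rcoefs (c *: 'X^n)); last first.
  by exists (A + c *: 'X^n); rewrite of_rcoefsD -fE subrK.
apply/leq_sizeP => j; rewrite leq_eqVlt coefB => /predU1P[<-|lt_nj].
  by rewrite cm subrr.
by rewrite !nth_default ?subr0 // ?(leq_trans sf) // (leq_trans sm).
Qed.

Lemma rcoefsK (f : R) : of_rcoefs (rcoefs f) = f.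
Proof. by symmetry; apply: (xgetPex 0 (of_rcoefs_surj f)). Qed.

End DivisionRing.
End SkewPoly.

Section Dieudonne.
Variable F : unitRingType.

Inductive derived_subgroup : F -> Prop :=
| derived_subgroup1 : derived_subgroup 1
| derived_subgroupR u v c : u \is a GRing.unit -> v \is a GRing.unit ->
    derived_subgroup c -> derived_subgroup (u * v * u^-1 * v^-1 * c).

Lemma derived_subgroupM c d :
  derived_subgroup c -> derived_subgroup d -> derived_subgroup (c * d).
Proof.
move=> cP dP; elim: cP => [|u v b uu vu _ IH]; first by rewrite mul1r.
by rewrite -mulrA; apply: derived_subgroupR.
Qed.

Lemma derived_subgroupV c :
  derived_subgroup c -> c \is a GRing.unit /\ derived_subgroup c^-1.
Proof.
elim=> [|u v b uu vu _ [bu IH]].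
  by rewrite invr1 unitr1; split=> //; apply: derived_subgroup1.
have xu : u * v * u^-1 * v^-1 \is a GRing.unit by rewrite !unitrMl ?unitrV.
split; first by rewrite unitrMl.
rewrite invrM //; apply: derived_subgroupM => //.
rewrite -[X in derived_subgroup X]mulr1.
have -> : (u * v * u^-1 * v^-1)^-1 = v * u * v^-1 * u^-1.
  by rewrite !invrM ?unitrV ?unitrMl ?unitrV // !invrK !mulrA.
by apply: derived_subgroupR => //; apply: derived_subgroup1.
Qed.

(* The class of 0 is {0} and the other classes of a division ring are the
   elements of F^* / [F^*, F^*], so the quotient is {0} \cup F^* / [F^*, F^*]. *)
Definition dieudonne_rel (a b : F) : bool :=
  `[< exists2 c, derived_subgroup c & a = c * b >].

Lemma dieudonne_rel_refl : reflexive dieudonne_rel.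
Proof.
by move=> a; apply/asboolP; exists 1; rewrite ?mul1r //; apply: derived_subgroup1.
Qed.

Lemma dieudonne_rel_sym : symmetric dieudonne_rel.
Proof.
suff H a b : dieudonne_rel a b -> dieudonne_rel b a by move=> a b; apply/idP/idP; apply: H.
move=> /asboolP[c /derived_subgroupV[cu cV] ->]; apply/asboolP.
by exists c^-1; rewrite ?mulKr.
Qed.

Lemma dieudonne_rel_trans : transitive dieudonne_rel.
Proof.
move=> b a d /asboolP[c cP ->] /asboolP[e eP ->]; apply/asboolP.
by exists (c * e); rewrite ?mulrA //; apply: derived_subgroupM.
Qed.

Canonical dieudonne_equiv :=
  EquivRel dieudonne_rel dieudonne_rel_refl dieudonne_rel_sym dieudonne_rel_trans.

Definition dieudonne_value : Type := {eq_quot dieudonne_equiv}%qT.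

Definition dieudonne_class (a : F) : dieudonne_value :=
  \pi_({eq_quot dieudonne_equiv})%qT a.

Lemma dieudonne_class_eq0 a : dieudonne_class a = dieudonne_class 0 <-> a = 0.
Proof.
split=> [/eqmodP/asboolP[c _ ->]|-> //]; exact: mulr0.
Qed.

(* Elimination of the first column: a pivot p in row i contributes (-1)^i p and
   leaves the Schur complement of p. *)
Fixpoint dieudonne_repr (n : nat) : 'M[F]_n -> F :=
  if n is m.+1 then fun A : 'M[F]_m.+1 =>
    if [pick i | A i ord0 != 0] is Some i then
      (-1) ^+ i * A i ord0 *
      dieudonne_repr (\matrix_(k < m, l < m)
        (A (lift i k) (lift ord0 l) -
         A (lift i k) ord0 * (A i ord0)^-1 * A i (lift ord0 l)))
    else 0
  else fun=> 1.

Definition dieudonne_det (n : nat) (A : 'M[F]_n) : dieudonne_value :=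
  dieudonne_class (dieudonne_repr A).

End Dieudonne.

Section Resultants.
Variables (F : unitRingType) (sigma : {rmorphism F -> F}).
Variable delta : sigma_derivation sigma.
Local Notation R := (skew_poly delta).
Local Notation X := (skewX delta).

Definition rsylvester (h k : R) : 'M[F]_(deg h + deg k) :=
  \matrix_(i, j) (if (i < deg k)%N then X ^+ i * h
                  else X ^+ (i - deg k) * k)`_j.

Definition lsylvester (h k : R) : 'M[F]_(deg h + deg k) :=
  \matrix_(i, j) (rcoefs (if (i < deg k)%N then h * X ^+ i
                          else k * X ^+ (i - deg k)))`_j.

Definition rresultant (h k : R) : dieudonne_value F :=
  dieudonne_det (rsylvester h k).

(* Right-hand coefficients live in right vector spaces, so the Dieudonne
   determinant of lsylvester is that of a matrix over the opposite ring of F,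
   whose value is the determinant of the transpose over F.  The determinant of
   lsylvester over F would not detect common left divisors: with sigma = id and
   delta = 0, for h = (x - b) (x - a) and k = x - b it is the class of
   a b - b a up to sign. *)
Definition lresultant (h k : R) : dieudonne_value F :=
  dieudonne_det (lsylvester h k)^T.

Definition linX (a : F) : R := X - skewC delta a.

Definition reval (f : R) (a : F) : F := (rrem f (linX a))`_0.
Definition leval (f : R) (a : F) : F := (lrem f (linX a))`_0.

Definition rroot (f : R) (a : F) : Prop := reval f a = 0.
Definition lroot (f : R) (a : F) : Prop := leval f a = 0.

Definition rroot_mult_ge (f : R) (a : F) (r : nat) : Prop :=
  rdivides (linX a ^+ r) f.
Definition lroot_mult_ge (f : R) (a : F) (r : nat) : Prop :=
  ldivides (linX a ^+ r) f.

Definition rDelta (a : F) (r : nat) (f : R) : R :=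
  if r is 0 then f else rquo f (linX a ^+ r).
Definition lDelta (a : F) (r : nat) (f : R) : R :=
  if r is 0 then f else lquo f (linX a ^+ r).

End Resultants.

(* Main.v *)
(* Put g_j = Delta_a^j f.  Uniqueness of the division gives
   g_j = g_{j+1} (x - a) + c_j with c_j = g_j(a) in F, so (x - a)^r divides f
   exactly when c_0 = ... = c_{r-1} = 0.  The resultant of h and k vanishes
   exactly when h u + k w = 0 has a nontrivial solution with deg u < deg k and
   deg w < deg h.  For h = k (x - a) + c with deg k > 0, such a relation reads
   k ((x - a) u + w) + c u = 0, a division of 0 by k with remainder c u: if
   c <> 0 then u = w = 0, and h and k generate the unit ideal, while for c = 0
   there is the relation h - k (x - a) = 0 and k is a common divisor.  The left
   version is the mirror image. *)
Require Import Defs.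
From mathcomp Require Import all_boot all_order all_algebra.

Set Implicit Arguments.
Unset Strict Implicit.

Import GRing.Theory.
Local Open Scope ring_scope.

(** * Null vectors and the vanishing of the Dieudonné determinant *)

Section NullVectors.
Variables (F : unitRingType) (F_div : division_ring F).

(** The matrix left by one elimination step of [dieudonne_repr], kept rectangular to serve the
    dimension count in [tall_row_null]. *)
Definition schur_compl m n (A : 'M[F]_(m.+1, n.+1)) (i : 'I_m.+1) : 'M[F]_(m, n) :=
  \matrix_(k, l) (A (lift i k) (lift ord0 l) -
    A (lift i k) ord0 * (A i ord0)^-1 * A i (lift ord0 l)).

(** Null rows correspond by dropping entry [i]: the pivot being invertible, column 0 of [v *m A = 0]
    recovers that entry from the others. *)
Lemma schur_compl_row_null m n (A : 'M[F]_(m.+1, n.+1)) i : A i ord0 != 0 ->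
  (exists2 v : 'rV_m.+1, v != 0 & v *m A = 0) <->
  (exists2 v : 'rV_m, v != 0 & v *m schur_compl A i = 0).
Proof.
move=> /F_div pu; set p := A i ord0 in pu *.
have key (v : 'rV[F]_m) l :
    (v *m schur_compl A i) 0 l = \sum_k v 0 k * A (lift i k) (lift ord0 l) -
      (\sum_k v 0 k * A (lift i k) ord0) * p^-1 * A i (lift ord0 l).
  rewrite !mxE !mulr_suml -sumrB; apply: eq_bigr => k _.
  by rewrite !mxE mulrBr !mulrA.
split=> [[v v0 vA]|[v v0 vS]].
  have vl l : v 0 i * A i l = - \sum_k v 0 (lift i k) * A (lift i k) l.
    move/matrixP/(_ 0 l): vA; rewrite !mxE (bigD1_ord i) //= => /eqP.
    by rewrite addr_eq0 => /eqP.
  have vk l : \sum_k col' i v 0 k * A (lift i k) l = - (v 0 i * A i l).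
    by rewrite vl opprK; apply: eq_bigr => k _; rewrite mxE.
  exists (col' i v); last first.
    by apply/rowP => l; rewrite key !vk mxE mulNr mulrK // mulNr opprK addNr.
  (* If the other entries vanish, the equation of column 0 reduces to [v 0 i * p = 0]. *)
  apply: contra_neq v0 => v'0; have vi : v 0 i = 0.
    move/eqP: (vk ord0); rewrite v'0 big1 => [|k _]; last by rewrite mxE mul0r.
    rewrite eq_sym oppr_eq0 => /eqP /(congr1 (fun x => x / p)).
    by rewrite mulrK // mul0r.
  apply/rowP => k; rewrite mxE; case: (unliftP i k) => [k'|] -> //.
  by move/rowP/(_ k'): v'0; rewrite !mxE.
pose c := - ((\sum_k v 0 k * A (lift i k) ord0) / p).
pose u : 'rV[F]_m.+1 := \row_k oapp (v 0) c (unlift i k).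
have ui : u 0 i = c by rewrite mxE unlift_none.
have uk k : u 0 (lift i k) = v 0 k by rewrite mxE liftK.
exists u; first by apply: contra_neq v0 => u0; apply/rowP => k; rewrite -uk u0 !mxE.
have eu l : \sum_k u 0 (lift i k) * A (lift i k) l = \sum_k v 0 k * A (lift i k) l.
  by apply: eq_bigr => k _; rewrite uk.
apply/rowP => l; rewrite !mxE (bigD1_ord i) //= ui eu.
case: (unliftP ord0 l) => [l'|] ->; last by rewrite mulNr divrK // addNr.
by rewrite mulNr addrC -[LHS](key v l') vS mxE.
Qed.

(** Here entry 0 is dropped, and row [i] of [A *m w = 0] recovers it. *)
Lemma schur_compl_col_null m n (A : 'M[F]_(m.+1, n.+1)) i : A i ord0 != 0 ->
  (exists2 w : 'cV_n.+1, w != 0 & A *m w = 0) <->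
  (exists2 w : 'cV_n, w != 0 & schur_compl A i *m w = 0).
Proof.
move=> /F_div pu; set p := A i ord0 in pu *.
have key (w : 'cV[F]_n) k :
    (schur_compl A i *m w) k 0 = \sum_l A (lift i k) (lift ord0 l) * w l 0 -
      A (lift i k) ord0 * (p^-1 * \sum_l A i (lift ord0 l) * w l 0).
  rewrite !mxE !mulr_sumr -sumrB; apply: eq_bigr => l _.
  by rewrite !mxE mulrBl !mulrA.
split=> [[w w0 Aw]|[w w0 Sw]].
  have wk k : \sum_l A k (lift ord0 l) * row' ord0 w l 0 = - (A k ord0 * w ord0 0).
    move/matrixP/(_ k 0): Aw; rewrite !mxE big_ord_recl => /eqP.
    rewrite addrC addr_eq0 => /eqP <-; apply: eq_bigr => l _; rewrite mxE.
    by [].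
  exists (row' ord0 w); last first.
    by apply/colP => k; rewrite key !wk mxE mulrN mulKr // mulrN opprK addNr.
  apply: contra_neq w0 => w'0; have wi : w ord0 0 = 0.
    move/eqP: (wk i); rewrite w'0 big1 => [|k _]; last by rewrite mxE mulr0.
    rewrite eq_sym oppr_eq0 => /eqP /(congr1 (fun x => p^-1 * x)).
    by rewrite mulKr // mulr0.
  apply/colP => k; rewrite mxE; case: (unliftP ord0 k) => [k'|] -> //.
  by move/colP/(_ k'): w'0; rewrite !mxE.
pose c := - (p^-1 * \sum_l A i (lift ord0 l) * w l 0).
pose u : 'cV[F]_n.+1 := \col_k oapp (w^~ 0) c (unlift ord0 k).
have ui : u ord0 0 = c by rewrite mxE unlift_none.
have uk k : u (lift ord0 k) 0 = w k 0 by rewrite mxE liftK.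
exists u; first by apply: contra_neq w0 => u0; apply/colP => k; rewrite -uk u0 !mxE.
have eu k : \sum_l A k (lift ord0 l) * u (lift ord0 l) 0 =
    \sum_l A k (lift ord0 l) * w l 0.
  by apply: eq_bigr => l _; rewrite uk.
apply/colP => k; rewrite !mxE big_ord_recl ui eu.
case: (unliftP i k) => [k'|] ->; last by rewrite mulrN mulVKr // addNr.
by rewrite mulrN addrC -[LHS](key w k') Sw mxE.
Qed.

Lemma mulmx_col'0_null m n (A : 'M[F]_(m, n.+1)) (v : 'rV_m) :
  (fun i => A i ord0 != 0) =1 xpred0 -> v *m col' ord0 A = 0 -> v *m A = 0.
Proof.
move=> A0 vA; apply/rowP => l; rewrite !mxE.
case: (unliftP ord0 l) => [l'|] ->.
  move/rowP/(_ l'): vA; rewrite !mxE => vAl; rewrite -[RHS]vAl.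
  by apply: eq_bigr => k _; rewrite mxE.
by apply: big1 => k _; have /negbFE/eqP -> := A0 k; rewrite mulr0.
Qed.

(** A pivot removes one row and one column, and a zero column can be discarded; rows thus remain
    when the columns are exhausted, and any nonzero vector is then null. *)
Lemma tall_row_null n m (A : 'M[F]_(m, n)) : (n < m)%N ->
  exists2 v : 'rV_m, v != 0 & v *m A = 0.
Proof.
elim: n m A => [|n IHn] [|m] // A ltnm.
  exists (const_mx 1); last by apply/rowP => -[].
  by apply/eqP => /rowP/(_ ord0)/eqP; rewrite !mxE oner_eq0.
have [i Ai|A0] := pickP (fun i => A i ord0 != 0).
  by apply/(schur_compl_row_null Ai); apply: IHn.
have [v v0 vA] := IHn _ (col' ord0 A) (ltnW ltnm).
exists v => //; exact: mulmx_col'0_null.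
Qed.

Lemma pivot_mul_eq0 (i : nat) (p d : F) : p != 0 -> (-1) ^+ i * p * d = 0 <-> d = 0.
Proof.
move=> /F_div pu; split=> [|->]; last by rewrite mulr0.
rewrite -mulrA => /(congr1 (fun x => (-1) ^+ i * x)); rewrite signrMK mulr0.
by move/(congr1 (fun x => p^-1 * x)); rewrite mulKr // mulr0.
Qed.

(** By [dieudonne_class_eq0] only the vanishing of the representative counts: a pivot multiplies it
    by a unit, and the Schur complement keeps the existence of null rows. *)
Lemma dieudonne_det_row_null n (A : 'M[F]_n) :
  dieudonne_det A = dieudonne_class 0 <-> exists2 v : 'rV_n, v != 0 & v *m A = 0.
Proof.
rewrite /dieudonne_det dieudonne_class_eq0; elim: n A => [|n IHn] A /=.
  split=> [/eqP|[v /eqP[]]]; first by rewrite oner_eq0.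
  by apply/rowP => -[].
case: pickP => [i Ai|A0].
  by rewrite pivot_mul_eq0 // IHn -(schur_compl_row_null Ai).
(* With a zero first column, n + 1 rows live in a space of dimension n. *)
split=> // _; have [v v0 vA] := tall_row_null (col' ord0 A) (ltnSn n).
exists v => //; exact: mulmx_col'0_null.
Qed.

(** Columns are combined with scalars on the right, as the transposed matrix in [lresultant]
    requires. *)
Lemma dieudonne_det_col_null n (A : 'M[F]_n) :
  dieudonne_det A = dieudonne_class 0 <-> exists2 w : 'cV_n, w != 0 & A *m w = 0.
Proof.
rewrite /dieudonne_det dieudonne_class_eq0; elim: n A => [|n IHn] A /=.
  split=> [/eqP|[w /eqP[]]]; first by rewrite oner_eq0.
  by apply/colP => -[].
case: pickP => [i Ai|A0].
  by rewrite pivot_mul_eq0 // IHn -(schur_compl_col_null Ai).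
(* The first column is zero, so the first basis vector is a null column. *)
split=> // _; exists (delta_mx ord0 0).
  by apply/eqP => /matrixP/(_ ord0 0)/eqP; rewrite !mxE !eqxx oner_eq0.
apply/colP => k; rewrite !mxE big_ord_recl mxE !eqxx mulr1.
have /negbFE/eqP -> := A0 k; rewrite add0r big1 // => l _.
by rewrite mxE /= mulr0.
Qed.

End NullVectors.

(** * Linear combinations of the rows of a Sylvester matrix *)

Lemma sum_ord_if (V : nmodType) m n (a b : nat -> V) :
  \sum_(i < m + n) (if (i < n)%N then a i else b (i - n)%N) =
  \sum_(i < n) a i + \sum_(i < m) b i.
Proof.
rewrite -(big_mkord xpredT (fun i => if (i < n)%N then a i else b (i - n)%N)).
rewrite (@big_cat_nat _ _ _ n) ?leq_addl //=; congr (_ + _).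
  by rewrite big_mkord; apply: eq_bigr => i _; rewrite ltn_ord.
rewrite -{1}[n]add0n big_addn addnK big_mkord.
by apply: eq_bigr => i _; rewrite ltnNge leq_addl addnK.
Qed.

Lemma ltn_sub_ord m n (i : 'I_(m + n)) : (n <= i)%N -> (i - n < m)%N.
Proof. by move=> leni; rewrite ltn_subLR // (leq_trans (ltn_ord i)) // addnC. Qed.

Section SkewResultants.
Variables (F : unitRingType) (sigma : {rmorphism F -> F}).
Variable delta : sigma_derivation sigma.
Local Notation R := (skew_poly delta).
Local Notation X := (skewX delta).
Local Notation C := (skewC delta).

Lemma skewX_expM i (p : R) : X ^+ i * p = iter i (skew_mulX delta) p.
Proof. by elim: i => [|i IHi]; rewrite ?mul1r // exprS -mulrA IHi mulXE. Qed.

Lemma skewCM c e : C (c * e) = C c * C e.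
Proof. by rewrite mulCE /skewC polyCM mul_polyC. Qed.

Lemma skewC_eq0 c : C c = 0 -> c = 0.
Proof. by move/eqP; rewrite polyC_eq0 => /eqP. Qed.

Lemma skew_mulEX N (p q : R) : (size p <= N)%N ->
  p * q = \sum_(i < N) C p`_i * (X ^+ i * q).
Proof.
move=> sp; rewrite [p * q](skew_mulE _ q sp); apply: eq_bigr => i _.
by rewrite mulCE skewX_expM.
Qed.

(** The bound on the sizes makes the [N] columns record every coefficient, so a relation between
    rows is an identity in [R]. *)
Lemma row_mul_coef_eq0 N (p : 'I_N -> R) (v : 'rV[F]_N) :
    (forall i, (size (p i) <= N)%N) ->
  v *m (\matrix_(i < N, j < N) (p i)`_j) = 0 <-> \sum_i C (v 0 i) * p i = 0.
Proof.
move=> sp; have coefE j : (\sum_i C (v 0 i) * p i)`_j = \sum_i v 0 i * (p i)`_j.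
  by rewrite coef_sum; apply: eq_bigr => i _; rewrite mulCE coefZ.
split=> [vM|s0]; last first.
  apply/rowP => j; rewrite !mxE -[RHS](coef0 F j) -[0 : {poly F}]/(0 : R) -s0 coefE.
  by apply: eq_bigr => i _; rewrite mxE.
apply/polyP => j; rewrite coef0 coefE; have [ltjN|leNj] := ltnP j N.
  move/rowP/(_ (Ordinal ltjN)): vM; rewrite !mxE => vMj; rewrite -[RHS]vMj.
  by apply: eq_bigr => i _; rewrite mxE.
by apply: big1 => i _; rewrite nth_default ?mulr0 // (leq_trans (sp i)).
Qed.

(** The first [deg k] rows carry [u] and the other [deg h] rows carry [w]; splitting the sum there
    leaves two products expanded by [skew_mulEX]. *)
Lemma rsylvester_comb (h k u w : R) : (size u <= deg k)%N -> (size w <= deg h)%N ->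
  \sum_(i < deg h + deg k) C (if (i < deg k)%N then u`_i else w`_(i - deg k)) *
    (if (i < deg k)%N then X ^+ i * h else X ^+ (i - deg k) * k) = u * h + w * k.
Proof.
move=> su sw; rewrite (skew_mulEX h su) (skew_mulEX k sw).
rewrite -(sum_ord_if _ _ (fun i => C u`_i * (X ^+ i * h)) (fun i => C w`_i * (X ^+ i * k))).
by apply: eq_bigr => i _; case: ifP.
Qed.

(** Right multiples are combinations of the [h * X ^+ i] and [k * X ^+ i] with scalars on the right,
    hence the right-hand coefficients [U] and [W]. *)
Lemma lsylvester_comb (h k : R) (U W : {poly F}) :
    (size U <= deg k)%N -> (size W <= deg h)%N ->
  \sum_(i < deg h + deg k) (if (i < deg k)%N then h * X ^+ i else k * X ^+ (i - deg k)) *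
    C (if (i < deg k)%N then U`_i else W`_(i - deg k)) =
  h * of_rcoefs delta U + k * of_rcoefs delta W.
Proof.
move=> sU sW; rewrite (of_rcoefsE delta sU) (of_rcoefsE delta sW) !mulr_sumr.
rewrite -(sum_ord_if _ _ (fun i => h * (X ^+ i * C U`_i)) (fun i => k * (X ^+ i * C W`_i))).
by apply: eq_bigr => i _; case: ifP; rewrite mulrA.
Qed.

Lemma leq_size_deg (p : R) : (size p <= (deg p).+1)%N.
Proof. exact: leqSpred. Qed.

Hypotheses (F_div : division_ring F) (sigma_bij : bijective sigma).

(** * Right-hand coefficients: right linearity and degree *)

Lemma of_rcoefsK (A : {poly F}) : rcoefs (of_rcoefs delta A) = A.
Proof. exact/(of_rcoefs_inj F_div)/rcoefsK. Qed.

(** In [{poly F}] the product by [c%:P] multiplies each coefficient by [c] on the right, which is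
    the effect of right multiplication by [C c] in [R]. *)
Lemma of_rcoefsMC (A : {poly F}) c :
  of_rcoefs delta (A * c%:P) = of_rcoefs delta A * C c.
Proof.
rewrite (@of_rcoefsE _ _ _ (size A)); last first.
  by apply/leq_sizeP => j lej; rewrite coefMC nth_default // mul0r.
by rewrite mulr_suml; apply: eq_bigr => i _; rewrite coefMC skewCM mulrA.
Qed.

Lemma rcoefsMC (p : R) c : rcoefs (p * C c) = rcoefs p * c%:P.
Proof. by rewrite -{1}(rcoefsK sigma_bij p) -of_rcoefsMC of_rcoefsK. Qed.

Lemma rcoefsD (p q : R) : rcoefs (p + q) = rcoefs p + rcoefs q.
Proof.
rewrite -{1}(rcoefsK sigma_bij p) -{1}(rcoefsK sigma_bij q).
by rewrite -of_rcoefsD of_rcoefsK.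
Qed.

Lemma of_rcoefs0 : of_rcoefs delta 0 = 0.
Proof. by rewrite /of_rcoefs size_poly0 big_ord0. Qed.

Lemma rcoefs0 : rcoefs (0 : R) = 0.
Proof. by have := of_rcoefsK 0; rewrite of_rcoefs0. Qed.

(** The top term x^n A_n has leading coefficient sigma^n(A_n), nonzero with A_n. *)
Lemma size_of_rcoefs (A : {poly F}) : size (of_rcoefs delta A) = size A.
Proof.
have [->|A0] := eqVneq A 0; first by rewrite of_rcoefs0.
have sA : (0 < size A)%N by rewrite lt0n size_poly_eq0.
have [] := @of_rcoefs_coef _ _ delta (size A).-1 A; first by rewrite prednK.
rewrite prednK // => le_s cA; apply/eqP; rewrite eqn_leq le_s leqNgt.
apply/negP => lt_s; move: cA; rewrite nth_default; last by rewrite -ltnS prednK.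
move=> c0; have := skew_iter_sigma_unit sigma F_div (size A).-1 (c := A`_(size A).-1).
by rewrite -c0 unitr0 -lead_coefE lead_coef_eq0 => /(_ A0).
Qed.

Lemma size_rcoefs (p : R) : size (rcoefs p) = size p.
Proof. by rewrite -{2}(rcoefsK sigma_bij p) size_of_rcoefs. Qed.

(** Transposing puts the scalars [w] on the right, where [rcoefs] is linear; by [size_rcoefs] no
    coefficient lies beyond [N]. *)
Lemma mul_col_rcoefs_eq0 N (p : 'I_N -> R) (w : 'cV[F]_N) :
    (forall i, (size (p i) <= N)%N) ->
  (\matrix_(i < N, j < N) (rcoefs (p i))`_j)^T *m w = 0 <-> \sum_i p i * C (w i 0) = 0.
Proof.
move=> sp; have coefE j :
    (rcoefs (\sum_i p i * C (w i 0)))`_j = \sum_i (rcoefs (p i))`_j * w i 0.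
  rewrite (big_morph _ rcoefsD rcoefs0) coef_sum; apply: eq_bigr => i _.
  by rewrite rcoefsMC coefMC.
split=> [wM|s0]; last first.
  apply/colP => j; rewrite !mxE -[RHS](coef0 F j) -rcoefs0 -s0 coefE.
  by apply: eq_bigr => i _; rewrite !mxE.
rewrite -[LHS](rcoefsK sigma_bij) -[RHS](rcoefsK sigma_bij).
congr of_rcoefs; apply/polyP => j; rewrite rcoefs0 coef0 coefE.
have [ltjN|leNj] := ltnP j N.
  move/colP/(_ (Ordinal ltjN)): wM; rewrite !mxE => wMj; rewrite -[RHS]wMj.
  by apply: eq_bigr => i _; rewrite !mxE.
by apply: big1 => i _; rewrite nth_default ?mul0r // size_rcoefs (leq_trans (sp i)).
Qed.

(** * Vanishing resultants as relations of bounded degree *)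

Lemma size_rsylvester_row (h k : R) (i : 'I_(deg h + deg k)) :
  (size (if (i < deg k)%N then X ^+ i * h else X ^+ (i - deg k) * k)%R
     <= deg h + deg k)%N.
Proof.
have sX n : (size (X ^+ n)%R <= n.+1)%N by rewrite skewXnE size_polyXn.
case: ifPn => [lti|].
  apply: leq_trans (skew_mul_coef (sX i) (leq_size_deg h)).1 _.
  by rewrite -addSn addnC leq_add2l.
rewrite -leqNgt => lei.
apply: leq_trans (skew_mul_coef (sX (i - deg k)%N) (leq_size_deg k)).1 _.
by rewrite subnK.
Qed.

Lemma size_lsylvester_row (h k : R) (i : 'I_(deg h + deg k)) :
  (size (if (i < deg k)%N then h * X ^+ i else k * X ^+ (i - deg k))%R
     <= deg h + deg k)%N.
Proof.
have sX n : (size (X ^+ n)%R <= n.+1)%N by rewrite skewXnE size_polyXn.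
case: ifPn => [lti|].
  apply: leq_trans (skew_mul_coef (leq_size_deg h) (sX i)).1 _.
  by rewrite -addnS leq_add2l.
rewrite -leqNgt => lei.
apply: leq_trans (skew_mul_coef (leq_size_deg k) (sX (i - deg k)%N)).1 _.
by rewrite subnKC.
Qed.

(** A null row of the Sylvester matrix lists [deg k] coefficients of [u], then [deg h] coefficients
    of [w]. *)
Lemma rresultant_eq0 (h k : R) :
  rresultant h k = dieudonne_class 0 <->
  exists u w : R, [/\ (size u <= deg k)%N, (size w <= deg h)%N,
    ~ (u = 0 /\ w = 0) & u * h + w * k = 0].
Proof.
rewrite /rresultant (dieudonne_det_row_null F_div); split; last first.
  move=> [u [w [su sw uw0 uw]]].
  exists (\row_(i < deg h + deg k) if (i < deg k)%N then u`_i else w`_(i - deg k)).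
    apply/eqP => /rowP v0; apply: uw0; split; apply/polyP => j; rewrite coef0.
      have [ltj|lej] := ltnP j (deg k); last by rewrite nth_default // (leq_trans su).
      have ltj' : (j < deg h + deg k)%N by rewrite (leq_trans ltj) ?leq_addl.
      by have := v0 (Ordinal ltj'); rewrite !mxE /= ltj.
    have [ltj|lej] := ltnP j (deg h); last by rewrite nth_default // (leq_trans sw).
    have ltj' : (j + deg k < deg h + deg k)%N by rewrite ltn_add2r.
    by have := v0 (Ordinal ltj'); rewrite !mxE /= ltnNge leq_addl addnK.
  apply/(row_mul_coef_eq0 _ (@size_rsylvester_row h k)).
  by under eq_bigr do rewrite mxE; rewrite rsylvester_comb.
move=> [v v0 /(row_mul_coef_eq0 _ (@size_rsylvester_row h k)) vS].
pose V := rVpoly v.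
exists (\poly_(i < deg k) V`_i), (\poly_(i < deg h) V`_(i + deg k)).
split; rewrite ?size_poly //.
  case=> u0 w0; case/eqP: v0; apply/rowP => i; rewrite mxE -coef_rVpoly_ord -/V.
  have [lti|lei] := ltnP i (deg k).
    by move/polyP/(_ i): u0; rewrite coef_poly lti coef0.
  by move/polyP/(_ (i - deg k)%N): w0; rewrite coef_poly coef0 subnK // ltn_sub_ord.
rewrite -rsylvester_comb ?size_poly // -[RHS]vS; apply: eq_bigr => i _.
congr (C _ * _); rewrite -coef_rVpoly_ord -/V !coef_poly; case: ltnP => // lei.
by rewrite subnK // ltn_sub_ord.
Qed.

(** The same cut, on right-hand coefficients: the size lemmas carry the degree bounds across,
    [rcoefsK] and [of_rcoefsK] the nontriviality. *)
Lemma lresultant_eq0 (h k : R) :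
  lresultant h k = dieudonne_class 0 <->
  exists u w : R, [/\ (size u <= deg k)%N, (size w <= deg h)%N,
    ~ (u = 0 /\ w = 0) & h * u + k * w = 0].
Proof.
rewrite /lresultant (dieudonne_det_col_null F_div); split; last first.
  move=> [u [w [su sw uw0 uw]]]; rewrite -size_rcoefs in su; rewrite -size_rcoefs in sw.
  set U := rcoefs u in su; set W := rcoefs w in sw.
  exists (\col_(i < deg h + deg k) if (i < deg k)%N then U`_i else W`_(i - deg k)).
    apply/eqP => /colP v0; apply: uw0.
    suff [U0 W0] : U = 0 /\ W = 0.
      by rewrite -(rcoefsK sigma_bij u) -(rcoefsK sigma_bij w) -/U -/W U0 W0
        of_rcoefs0.
    split; apply/polyP => j; rewrite coef0.
      have [ltj|lej] := ltnP j (deg k); last by rewrite nth_default // (leq_trans su).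
      have ltj' : (j < deg h + deg k)%N by rewrite (leq_trans ltj) ?leq_addl.
      by have := v0 (Ordinal ltj'); rewrite !mxE /= ltj.
    have [ltj|lej] := ltnP j (deg h); last by rewrite nth_default // (leq_trans sw).
    have ltj' : (j + deg k < deg h + deg k)%N by rewrite ltn_add2r.
    by have := v0 (Ordinal ltj'); rewrite !mxE /= ltnNge leq_addl addnK.
  apply/(mul_col_rcoefs_eq0 _ (@size_lsylvester_row h k)).
  by under eq_bigr do rewrite mxE; rewrite lsylvester_comb // !rcoefsK.
move=> [v v0 /(mul_col_rcoefs_eq0 _ (@size_lsylvester_row h k)) vS].
pose V := rVpoly v^T; have VE i : V`_(i : 'I_(deg h + deg k)) = v i 0.
  by rewrite coef_rVpoly_ord mxE.
pose U := \poly_(i < deg k) V`_i; pose W := \poly_(i < deg h) V`_(i + deg k).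
exists (of_rcoefs delta U), (of_rcoefs delta W).
split; rewrite ?size_of_rcoefs ?size_poly //.
  case=> /(congr1 (@rcoefs _ _ delta)) u0 /(congr1 (@rcoefs _ _ delta)) w0.
  rewrite !of_rcoefsK rcoefs0 in u0 w0.
  case/eqP: v0; apply/colP => i; rewrite mxE -VE.
  have [lti|lei] := ltnP i (deg k).
    by move/polyP/(_ i): u0; rewrite coef_poly lti coef0.
  by move/polyP/(_ (i - deg k)%N): w0; rewrite coef_poly coef0 subnK // ltn_sub_ord.
rewrite -lsylvester_comb ?size_poly // -[RHS]vS; apply: eq_bigr => i _.
congr (_ * C _); rewrite -VE !coef_poly; case: ltnP => // lei.
by rewrite subnK // ltn_sub_ord.
Qed.

(** * Powers of a linear factor *)

Local Notation L a := (linX delta a).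

Lemma size_linX a : size (L a) = 2%N.
Proof. exact: size_XsubC. Qed.

Lemma linX_neq0 a : L a != 0.
Proof. by rewrite -size_poly_eq0 size_linX. Qed.

Lemma size_linX_exp a j : size (L a ^+ j) = j.+1.
Proof.
elim: j => [|j IHj]; first exact: size_poly1.
have Lj0 : L a ^+ j != 0 by rewrite -size_poly_eq0 IHj.
by rewrite exprS size_skew_mul ?linX_neq0 // size_linX IHj.
Qed.

Lemma linX_exp_neq0 a j : L a ^+ j != 0.
Proof. by rewrite -size_poly_eq0 size_linX_exp. Qed.

Lemma size1_skew_monic (d : R) : skew_monic d -> size d = 1%N -> d = 1.
Proof.
move=> d1 sd; apply/polyP => i; rewrite coef1 -d1 lead_coefE sd /=.
by case: i => // i; rewrite nth_default // sd.
Qed.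

Lemma deg_gt0_neq0 (k : R) : (0 < deg k)%N -> k != 0.
Proof. by apply: contraTneq => ->; rewrite /deg size_poly0. Qed.

(** * Polynomials that differ by a constant from a multiple of [k] *)

Section AffineMultiple.
Variables (k : R) (a c : F).
Hypothesis deg_k : (0 < deg k)%N.

Let k0 : k != 0 := deg_gt0_neq0 deg_k.

Let size_k : size k = (deg k).+1.
Proof. by rewrite prednK // lt0n size_poly_eq0. Qed.

Let gt1_size_k : (1 < size k)%N.
Proof. by rewrite size_k. Qed.

(** A common right divisor divides [c] on the right, and a nonzero constant has only constant
    divisors; for [c = 0] the nonconstant [k] is itself a common divisor. *)
Lemma gcrd_affine : gcrd (L a * k + C c) k <> 1 <-> c = 0.
Proof.
have [d1 [q hE] [s kE] dmax] := gcrdP F_div (or_intror k0 : L a * k + C c != 0 \/ k != 0).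
split=> [gN1|c0 g1].
  apply/eqP; apply: contra_notT gN1 => c0; apply: size1_skew_monic => //.
  set d := gcrd _ _ in d1 hE kE *; have d0 := skew_monic_neq0 d1.
  have cE : C c = (q - L a * s) * d.
    by rewrite mulrBl -hE -mulrA -kE addrC addKr.
  have e0 : q - L a * s != 0.
    by apply: contra_neq c0 => e0; apply: skewC_eq0; rewrite cE e0 mul0r.
  move/(congr1 (fun p : R => size p)): cE; rewrite size_polyC c0 size_skew_mul //.
  move: e0 d0; rewrite -!size_poly_eq0; case: (size _) => // i _.
  by case: (size _) => // j _; rewrite addSn addnS /= => -[/esym/eqP]; rewrite addn_eq0 => /andP[_ /eqP->].
(* [k] divides the gcrd, so a gcrd equal to 1 would force [k] to be constant. *)
have [||q' /(congr1 (fun p : R => size p))] := dmax k.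
- by exists (L a); rewrite c0 /skewC addr0.
- by exists 1; rewrite mul1r.
rewrite g1 size_poly1 => e; have q'0 : q' != 0.
  by apply/eqP => q'0; move: e; rewrite q'0 mul0r size_poly0.
move: e; rewrite size_skew_mul //; move: q'0 gt1_size_k; rewrite -size_poly_eq0.
by case: (size q') => // i _; case: (size k) => [|[|j]] //; rewrite addSn !addnS.
Qed.

(** With [k] as the left factor, common left divisors divide [c] on the left; this is why right
    roots are detected by the gcld. *)
Lemma gcld_affine : gcld (k * L a + C c) k <> 1 <-> c = 0.
Proof.
have [d1 [q hE] [s kE] dmax] :=
  gcldP F_div sigma_bij (or_intror k0 : k * L a + C c != 0 \/ k != 0).
split=> [gN1|c0 g1].
  apply/eqP; apply: contra_notT gN1 => c0; apply: size1_skew_monic => //.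
  set d := gcld _ _ in d1 hE kE *; have d0 := skew_monic_neq0 d1.
  have cE : C c = d * (q - s * L a).
    by rewrite mulrBr -hE mulrA -kE addrC addKr.
  have e0 : q - s * L a != 0.
    by apply: contra_neq c0 => e0; apply: skewC_eq0; rewrite cE e0 mulr0.
  move/(congr1 (fun p : R => size p)): cE; rewrite size_polyC c0 size_skew_mul //.
  move: e0 d0; rewrite -!size_poly_eq0; case: (size _) => // i _.
  by case: (size _) => // j _; rewrite addSn addnS /= => -[/esym/eqP]; rewrite addn_eq0 => /andP[/eqP-> _].
have [||q' /(congr1 (fun p : R => size p))] := dmax k.
- by exists (L a); rewrite c0 /skewC addr0.
- by exists 1; rewrite mulr1.
rewrite g1 size_poly1 => e; have q'0 : q' != 0.
  by apply/eqP => q'0; move: e; rewrite q'0 mulr0 size_poly0.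
move: e; rewrite size_skew_mul //; move: q'0 gt1_size_k; rewrite -size_poly_eq0.
by case: (size q') => // i _; case: (size k) => [|[|j]] //; rewrite addSn !addnS.
Qed.

Lemma rresultant_affine : rresultant (L a * k + C c) k = dieudonne_class 0 <-> c = 0.
Proof.
rewrite rresultant_eq0; split=> [[u [w [su _ uw0 e]]]|->].
  apply/eqP; apply/negP => /negP c0; apply: uw0.
  have sc : size (C c) = 1%N by rewrite size_polyC c0.
  have Cc0 : C c != 0 by rewrite -size_poly_eq0 sc.
  (* The bound [size u <= deg k] makes [u * C c] a legitimate remainder modulo [k]. *)
  have suc : (size (u * C c)%R < size k)%N.
    have [->|u0] := eqVneq u 0; first by rewrite mul0r size_poly0 size_k.
    by rewrite size_skew_mul // sc addn1 size_k.
  have div0 : is_rdivision 0 k (0, 0) by split; rewrite /= ?mul0r ?addr0 ?size_poly0 ?size_k.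
  have div_e : is_rdivision 0 k (u * L a + w, u * C c).
    by split=> //=; rewrite -[LHS]e mulrDr [(_ + w) * k]mulrDl mulrA addrAC.
  have [w0 uc] := rdivision_uniq F_div div_e div0; have u0 : u = 0.
    by apply/eqP; apply: contraPT uc => u0; apply/eqP/skew_mul_neq0.
  by move: w0; rewrite u0 mul0r add0r.
(* This is the relation [1 * h - L a * k = 0]; its size bounds amount to 1 <= deg k and 2 <= deg k +
   1. *)
exists 1, (- L a); split; first by rewrite size_poly1.
- rewrite size_polyN size_linX /skewC addr0 /deg size_skew_mul ?linX_neq0 //.
  by rewrite size_linX size_k.
- by case=> /eqP; rewrite oner_eq0.
by rewrite /skewC addr0 mul1r mulNr subrr.
Qed.

Lemma lresultant_affine : lresultant (k * L a + C c) k = dieudonne_class 0 <-> c = 0.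
Proof.
rewrite lresultant_eq0; split=> [[u [w [su _ uw0 e]]]|->].
  apply/eqP; apply/negP => /negP c0; apply: uw0.
  have sc : size (C c) = 1%N by rewrite size_polyC c0.
  have Cc0 : C c != 0 by rewrite -size_poly_eq0 sc.
  have suc : (size (C c * u)%R < size k)%N.
    have [->|u0] := eqVneq u 0; first by rewrite mulr0 size_poly0 size_k.
    by rewrite size_skew_mul // sc add1n size_k.
  have div0 : is_ldivision 0 k (0, 0) by split; rewrite /= ?mulr0 ?addr0 ?size_poly0 ?size_k.
  have div_e : is_ldivision 0 k (L a * u + w, C c * u).
    by split=> //=; rewrite -[LHS]e [(_ + C c) * u]mulrDl [k * (_ + w)]mulrDr mulrA addrAC.
  (* The zero remainder [C c * u] forces [u = 0], and the zero quotient then forces [w = 0]. *)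
  have [w0 uc] := ldivision_uniq F_div div_e div0; have u0 : u = 0.
    by apply/eqP; apply: contraPT uc => u0; apply/eqP/skew_mul_neq0.
  by move: w0; rewrite u0 mulr0 add0r.
exists 1, (- L a); split; first by rewrite size_poly1.
- rewrite size_polyN size_linX /skewC addr0 /deg size_skew_mul ?linX_neq0 //.
  by rewrite size_linX size_k addn2.
- by case=> /eqP; rewrite oner_eq0.
by rewrite /skewC addr0 mulr1 mulrN subrr.
Qed.

End AffineMultiple.

(** * Successive quotients by powers of [L a] *)

Section Quotients.
Variables (f : R) (a : F).

(** The convention for [j = 0] agrees with division by [L a ^+ 0 = 1] with remainder 0, so all [j]
    can be treated alike. *)
Lemma rDelta_spec j : exists2 s : R, f = rDelta a j f * L a ^+ j + s & (size s <= j)%N.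
Proof.
case: j => [|j]; first by exists 0; rewrite ?size_poly0 // mulr1 addr0.
have [fE lts] := rdivisionP F_div f (linX_exp_neq0 a j.+1).
by exists (rrem f (L a ^+ j.+1)) => //; rewrite size_linX_exp in lts.
Qed.

Lemma lDelta_spec j : exists2 s : R, f = L a ^+ j * lDelta a j f + s & (size s <= j)%N.
Proof.
case: j => [|j]; first by exists 0; rewrite ?size_poly0 // mul1r addr0.
have [fE lts] := ldivisionP F_div sigma_bij f (linX_exp_neq0 a j.+1).
by exists (lrem f (L a ^+ j.+1)) => //; rewrite size_linX_exp in lts.
Qed.

Lemma rDelta_uniq j (q s : R) :
  f = q * L a ^+ j + s -> (size s <= j)%N -> rDelta a j f = q.
Proof.
move=> fE les; have [s' fE' les'] := rDelta_spec j.
have divq : is_rdivision f (L a ^+ j) (q, s) by split; rewrite ?size_linX_exp.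
have divD : is_rdivision f (L a ^+ j) (rDelta a j f, s') by split; rewrite ?size_linX_exp.
by have [] := rdivision_uniq F_div divD divq.
Qed.

Lemma lDelta_uniq j (q s : R) :
  f = L a ^+ j * q + s -> (size s <= j)%N -> lDelta a j f = q.
Proof.
move=> fE les; have [s' fE' les'] := lDelta_spec j.
have divq : is_ldivision f (L a ^+ j) (q, s) by split; rewrite ?size_linX_exp.
have divD : is_ldivision f (L a ^+ j) (lDelta a j f, s') by split; rewrite ?size_linX_exp.
by have [] := ldivision_uniq F_div divD divq.
Qed.

End Quotients.

Lemma rdiv_linX (p : R) a : p = rquo p (L a) * L a + C (reval p a).
Proof.
have [pE lts] := rdivisionP F_div p (linX_neq0 a); rewrite size_linX ltnS in lts.
by rewrite {1}pE [X in _ + X](size1_polyC lts).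
Qed.

Lemma ldiv_linX (p : R) a : p = L a * lquo p (L a) + C (leval p a).
Proof.
have [pE lts] := ldivisionP F_div sigma_bij p (linX_neq0 a); rewrite size_linX ltnS in lts.
by rewrite {1}pE [X in _ + X](size1_polyC lts).
Qed.

Lemma reval_mul_linX (q : R) a : reval (q * L a) a = 0.
Proof.
have := rdivisionP F_div (q * L a) (linX_neq0 a).
have q0 : is_rdivision (q * L a) (L a) (q, 0).
  by split; rewrite /= ?addr0 // size_poly0 size_linX.
by move/(rdivision_uniq F_div q0); rewrite /reval /rrem => <-; rewrite coef0.
Qed.

Lemma leval_mul_linX (q : R) a : leval (L a * q) a = 0.
Proof.
have := ldivisionP F_div sigma_bij (L a * q) (linX_neq0 a).
have q0 : is_ldivision (L a * q) (L a) (q, 0).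
  by split; rewrite /= ?addr0 // size_poly0 size_linX.
by move/(ldivision_uniq F_div q0); rewrite /leval /lrem => <-; rewrite coef0.
Qed.

Lemma size_skewC_mul_leq c (p : R) : (size (C c * p)%R <= size p)%N.
Proof. by rewrite mulCE size_scale_leq. Qed.

(** Right multiplication by a constant does not act coefficientwise on left coefficients, so the
    bound comes from the size formula for products. *)
Lemma size_mul_skewC_leq c (p : R) : (size (p * C c)%R <= size p)%N.
Proof.
have [->|p0] := eqVneq p 0; first by rewrite mul0r.
have [->|c0] := eqVneq c 0; first by rewrite /skewC mulr0 size_poly0.
have Cc0 : C c != 0 by rewrite polyC_eq0.
by rewrite size_skew_mul // size_polyC c0 addn1.
Qed.

(** Dividing [g] by [L a] inside [f = g * L a ^+ j + s] yields a division of [f] by [L a ^+ j.+1],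
    with remainder [C c * L a ^+ j + s] for [c = reval g a]. *)
Lemma rDeltaS (f : R) a j :
  rDelta a j f = rDelta a j.+1 f * L a + C (reval (rDelta a j f) a).
Proof.
set g := rDelta a j f; have [s fE les] := rDelta_spec f a j; rewrite -/g in fE.
suff -> : rDelta a j.+1 f = rquo g (L a) by apply: rdiv_linX.
apply: (@rDelta_uniq _ _ _ _ (C (reval g a) * L a ^+ j + s)).
  by rewrite {1}fE {1}(rdiv_linX g a) mulrDl -mulrA -exprS addrA.
rewrite (leq_trans (size_polyD _ _)) // geq_max (leqW les) andbT.
by rewrite (leq_trans (size_skewC_mul_leq _ _)) // size_linX_exp.
Qed.

Lemma lDeltaS (f : R) a j :
  lDelta a j f = L a * lDelta a j.+1 f + C (leval (lDelta a j f) a).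
Proof.
set g := lDelta a j f; have [s fE les] := lDelta_spec f a j; rewrite -/g in fE.
suff -> : lDelta a j.+1 f = lquo g (L a) by apply: ldiv_linX.
apply: (@lDelta_uniq _ _ _ _ (L a ^+ j * C (leval g a) + s)).
  by rewrite {1}fE {1}(ldiv_linX g a) mulrDr mulrA -exprSr addrA.
rewrite (leq_trans (size_polyD _ _)) // geq_max (leqW les) andbT.
by rewrite (leq_trans (size_mul_skewC_leq _ _)) // size_linX_exp.
Qed.

(** A constant quotient would give [f] degree at most [j]. Applied at [j.+1], this is how
    [r < deg f] makes the second polynomial of each pair nonconstant. *)
Lemma deg_rDelta_gt0 (f : R) a j : (j < deg f)%N -> (0 < deg (rDelta a j f))%N.
Proof.
have [s fE les] := rDelta_spec f a j; apply: contraTT; rewrite -leqNgt -leqNgt leqn0.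
set q := rDelta a j f in fE * => /eqP q0.
have sq : (size q <= 1)%N by rewrite (leq_trans (leq_size_deg q)) ?q0.
have [] := skew_mul_coef sq (eq_leq (size_linX_exp a j)); rewrite add0n => le1 _.
have : (size f <= j.+1)%N.
  by rewrite fE (leq_trans (size_polyD _ _)) // geq_max le1 leqW.
by rewrite /deg; case: (size f).
Qed.

Lemma deg_lDelta_gt0 (f : R) a j : (j < deg f)%N -> (0 < deg (lDelta a j f))%N.
Proof.
have [s fE les] := lDelta_spec f a j; apply: contraTT; rewrite -leqNgt -leqNgt leqn0.
set q := lDelta a j f in fE * => /eqP q0.
have sq : (size q <= 1)%N by rewrite (leq_trans (leq_size_deg q)) ?q0.
have [] := skew_mul_coef (eq_leq (size_linX_exp a j)) sq; rewrite addn0 => le1 _.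
have : (size f <= j.+1)%N.
  by rewrite fE (leq_trans (size_polyD _ _)) // geq_max le1 leqW.
by rewrite /deg; case: (size f).
Qed.

(** * Multiplicity and the criteria, read on the successive quotients *)

Lemma rroot_mult_geP (f : R) a r :
  rroot_mult_ge f a r <-> forall j, (j < r)%N -> rroot (rDelta a j f) a.
Proof.
split=> [[q fE] j ltjr|root_f].
  (* One factor [L a] is split off [L a ^+ (r - j)], so that the quotient visibly vanishes at
     [a]. *)
  rewrite /rroot (@rDelta_uniq f a j (q * L a ^+ (r - j.+1) * L a) 0) ?size_poly0 //.
    exact: reval_mul_linX.
  by rewrite addr0 -!mulrA -exprS -exprD subnK.
(* All values being zero, [rDeltaS] pulls out one more factor at each step without remainder. *)
exists (rDelta a r f); elim: r root_f => [|r IHr] root_f; first by rewrite mulr1.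
rewrite {1}IHr => [|j ltjr]; last exact/root_f/ltnW.
by rewrite rDeltaS root_f // /skewC addr0 exprS mulrA.
Qed.

Lemma lroot_mult_geP (f : R) a r :
  lroot_mult_ge f a r <-> forall j, (j < r)%N -> lroot (lDelta a j f) a.
Proof.
split=> [[q fE] j ltjr|root_f].
  rewrite /lroot (@lDelta_uniq f a j (L a * (L a ^+ (r - j.+1) * q)) 0) ?size_poly0 //.
    exact: leval_mul_linX.
  by rewrite addr0 !mulrA -exprSr -exprD subnKC.
exists (lDelta a r f); elim: r root_f => [|r IHr] root_f; first by rewrite mul1r.
rewrite {1}IHr => [|j ltjr]; last exact/root_f/ltnW.
by rewrite lDeltaS root_f // /skewC addr0 exprSr mulrA.
Qed.

(** [rDeltaS] gives the affine shape, with the next quotient as [k] and the value at [a] as [c]. *)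
Lemma rroot_rDelta_lresultant (f : R) a j : (j.+1 < deg f)%N ->
  lresultant (rDelta a j f) (rDelta a j.+1 f) = dieudonne_class 0 <->
  rroot (rDelta a j f) a.
Proof. by move/(deg_rDelta_gt0 a) => k0; rewrite {1}rDeltaS lresultant_affine. Qed.

Lemma rroot_rDelta_gcld (f : R) a j : (j.+1 < deg f)%N ->
  gcld (rDelta a j f) (rDelta a j.+1 f) <> 1 <-> rroot (rDelta a j f) a.
Proof. by move/(deg_rDelta_gt0 a) => k0; rewrite {1}rDeltaS gcld_affine. Qed.

Lemma lroot_lDelta_rresultant (f : R) a j : (j.+1 < deg f)%N ->
  rresultant (lDelta a j f) (lDelta a j.+1 f) = dieudonne_class 0 <->
  lroot (lDelta a j f) a.
Proof. by move/(deg_lDelta_gt0 a) => k0; rewrite {1}lDeltaS rresultant_affine. Qed.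

Lemma lroot_lDelta_gcrd (f : R) a j : (j.+1 < deg f)%N ->
  gcrd (lDelta a j f) (lDelta a j.+1 f) <> 1 <-> lroot (lDelta a j f) a.
Proof. by move/(deg_lDelta_gt0 a) => k0; rewrite {1}lDeltaS gcrd_affine. Qed.

End SkewResultants.

Theorem theorem3p43 (F : unitRingType) (F_div : division_ring F)
    (sigma : {rmorphism F -> F}) (sigma_bij : bijective sigma)
    (delta : sigma_derivation sigma)
    (f : skew_poly delta) (a : F) (r : nat)
    (r_gt0 : (0 < r)%N) (r_lt : (r < deg f)%N) :
  [<-> rroot_mult_ge f a r;
       forall j, (j < r)%N -> rroot (rDelta a j f) a;
       forall j, (j < r)%N ->
         lresultant (rDelta a j f) (rDelta a j.+1 f) = dieudonne_class 0;
       forall j, (j < r)%N -> gcld (rDelta a j f) (rDelta a j.+1 f) <> 1]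
  /\
  [<-> lroot_mult_ge f a r;
       forall j, (j < r)%N -> lroot (lDelta a j f) a;
       forall j, (j < r)%N ->
         rresultant (lDelta a j f) (lDelta a j.+1 f) = dieudonne_class 0;
       forall j, (j < r)%N -> gcrd (lDelta a j f) (lDelta a j.+1 f) <> 1].
Proof.
have lt_deg j : (j < r)%N -> (j.+1 < deg f)%N by move=> ltjr; apply: leq_ltn_trans r_lt.
have rres j ltjr := rroot_rDelta_lresultant F_div sigma_bij a (lt_deg j ltjr).
have rgcd j ltjr := rroot_rDelta_gcld F_div sigma_bij a (lt_deg j ltjr).
have lres j ltjr := lroot_lDelta_rresultant F_div sigma_bij a (lt_deg j ltjr).
have lgcd j ltjr := lroot_lDelta_gcrd F_div sigma_bij a (lt_deg j ltjr).
split; tfae.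
- by move/(rroot_mult_geP F_div).
- by move=> root_f j ltjr; apply/(rres _ ltjr)/root_f.
- by move=> res0 j ltjr; apply/(rgcd _ ltjr)/(rres _ ltjr)/res0.
(* The cycle closes through 2): the gcld criterion gives all the roots, hence the multiplicity. *)
- by move=> gcdN1; apply/(rroot_mult_geP F_div) => j ltjr; apply/(rgcd _ ltjr)/gcdN1.
- by move/(lroot_mult_geP F_div sigma_bij).
- by move=> root_f j ltjr; apply/(lres _ ltjr)/root_f.
- by move=> res0 j ltjr; apply/(lgcd _ ltjr)/(lres _ ltjr)/res0.
- by move=> gcdN1; apply/(lroot_mult_geP F_div sigma_bij) => j ltjr; apply/(lgcd _ ltjr)/gcdN1.
Qed.
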